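(* Let $R\in{\mathbb Z}_{>0}^m$, $C\in{\mathbb Z}_{>0}^n$, and $K=(k_{ij})\in{\mathbb Z}_{>0}^{m\times n}$, and assume $T_K(R,C)>0$. Then $$\lim_{s\rightarrow\infty} \frac{1}{s^2} \ln T_{K^{(s)}}(R^{(s)},C^{(s)}) \;=\; \ln\left(\inf_{x_1,\ldots,x_m,y_1,\ldots,y_n>0} \frac{G({\bf x},{\bf y})}{{\bf x}^R{\bf y}^C} \right),$$ where $$G({\bf x},{\bf y}) := \prod_{i=1}^m \prod_{j=1}^n \big[1+x_iy_j+(x_iy_j)^2+\cdots+(x_iy_j)^{k_{ij}}\big],$$ ${\bf x}^R=x_1^{r_1}\cdots x_m^{r_m}$ and ${\bf y}^C=y_1^{c_1}\cdots y_n^{c_n}$.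
   Context: For $R\in{\mathbb Z}_{\geq 0}^m$, $C\in{\mathbb Z}_{\geq 0}^n$, $K\in{\mathbb Z}_{\geq 0}^{m\times n}$, $T_K(R,C)$ is the number of nonnegative integer $m\times n$ matrices $A=(a_{ij})$ with row sums $r_i$, column sums $c_j$, and $a_{ij}\leq k_{ij}$ for all $i,j$. Cloning: for an integer $s\geq 1$, $R^{(s)}=(sr_1,\ldots,sr_m,\ sr_1,\ldots,sr_m,\ \ldots,\ sr_1,\ldots,sr_m)\in{\mathbb Z}^{sm}$ ($s$ repetitions of the block $sR$), similarly $C^{(s)}\in{\mathbb Z}^{sn}$ consists of $s$ repetitions of $sC$, and $K^{(s)}$ is the $sm\times sn$ block matrix with all $s\times s$ blocks equal to $K$. *)

(* Defs.v *)
(* MathComp / MathComp-Analysis. *)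
From HB Require Import structures.
From mathcomp Require Import all_boot all_order all_algebra finmap.
From mathcomp Require Import all_classical all_reals all_analysis.
Set Implicit Arguments.
Unset Strict Implicit.
Unset Printing Implicit Defensive.
Import Order.TTheory GRing.Theory Num.Theory.
Import numFieldNormedType.Exports.
Local Open Scope classical_set_scope.
Local Open Scope ring_scope.

Definition tables (m n : nat) (K : 'M[nat]_(m, n)) (R : 'rV[nat]_m)
    (C : 'rV[nat]_n) : set 'M[nat]_(m, n) :=
  [set A | [/\ (forall i, (\sum_(j < n) A i j)%N = R 0 i),
               (forall j, (\sum_(i < m) A i j)%N = C 0 j) &
               (forall i j, (A i j <= K i j)%N)]].

(* [fset_set] is a dummy value on infinite sets; this case never occurs in
   [num_tables]. *)
Lemma finite_tables (m n : nat) (K : 'M[nat]_(m, n)) (R : 'rV[nat]_m)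
    (C : 'rV[nat]_n) : finite_set (tables K R C).
Proof.
pose B := (\max_(i < m) \max_(j < n) K i j)%N.
apply: (@sub_finite_set _ _
  (range (fun A : 'M['I_B.+1]_(m, n) => map_mx (@nat_of_ord _) A))); last first.
  exact/finite_image/finite_finset.
move=> A [_ _ leAK] /=; exists (\matrix_(i, j) inord (A i j)) => //.
apply/matrixP => i j; rewrite !mxE inordK // ltnS (leq_trans (leAK i j)) //.
apply: (leq_trans (leq_bigmax j)).
exact: (leq_bigmax (F := fun i => \max_(j < n) K i j)%N).
Qed.

Definition num_tables (m n : nat) (K : 'M[nat]_(m, n)) (R : 'rV[nat]_m)
    (C : 'rV[nat]_n) : nat :=
  #|` fset_set (tables K R C)|%fset.

(* The dimensions of the clones are [\sum_(a < s) m] and [\sum_(a < s) n],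
   that is [s * m] and [s * n]; [R *+ s] is the vector with entries
   [s * R 0%R i]. *)
Definition clone_margin (s m : nat) (R : 'rV[nat]_m) :
    'rV[nat]_(\sum_(a < s) m) :=
  \mxrow_(a < s) (R *+ s).

Definition clone_bound (s m n : nat) (K : 'M[nat]_(m, n)) :
    'M[nat]_(\sum_(a < s) m, \sum_(b < s) n) :=
  \mxblock_(a < s, b < s) K.

Definition genfun (F : realType) (m n : nat) (K : 'M[nat]_(m, n))
    (x : 'rV[F]_m) (y : 'rV[F]_n) : F :=
  \prod_(i < m) \prod_(j < n) \sum_(t < (K i j).+1) (x 0 i * y 0 j) ^+ t.

Definition monomial (F : realType) (m : nat) (R : 'rV[nat]_m)
    (x : 'rV[F]_m) : F :=
  \prod_(i < m) x 0 i ^+ R 0 i.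

(* Main.v *)
(* Write [T_s] for the number of clones of order [s], seen as the [s] by [s]
   tables of [m] by [n] blocks.  Expanding [G(x, y)^(s^2)] and keeping the terms
   of the clones gives [T_s <= (G / x^R y^C)^(s^2)], the upper bound.

   Since [T_(qr + t) >= T_r^(q^2)], it is enough for the lower bound to find, for
   every [e], a single [r] with [ln T_r / r^2 >= ln inf - e].
   - By convex duality there is a distribution on the blocks whose mean margins
     are almost [(R, C)] and whose entropy is almost [ln inf]; by Dirichlet's
     approximation theorem it may be taken rational with mean exactly [(R, C)].
   - Counting the words of this type, there are [e^(s^2 (ln inf - e))] ways to
     fill an [s] by [s] table of blocks so that the blocks sum up to
     [s^2 (R, C)].  There are only [e^(O(s ln s))] possible margins, so a family
     [X] of [e^(s^2 (ln inf - 2 e))] of them have the same margins.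
   - Arranging [s^2] elements of [X], cyclically translated, in an [s] by [s]
     pattern averages these margins and yields [#|X|^(s^2)] clones of order
     [s^2]. *)
Require Import Defs.
From mathcomp Require Import all_boot all_order all_algebra.
From mathcomp Require Import all_classical all_reals all_analysis.
From mathcomp Require Import finmap ring lra.
Set Implicit Arguments.
Unset Strict Implicit.
Unset Printing Implicit Defensive.
Import Order.TTheory GRing.Theory Num.Theory.
Import numFieldNormedType.Exports.

(** * Counting clones *)

Lemma sum_count_mem (T : finType) (s : seq T) :
  (\sum_x count_mem x s = size s)%N.
Proof.
rewrite -sum1_size; under eq_bigr do rewrite -sum1_count big_mkcond.
rewrite exchange_big /=; apply: eq_bigr => y _.
rewrite (bigD1 y) //= eqxx big1 ?addn0 // => x /negPf.
by rewrite eq_sym => ->.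
Qed.

(** Multinomial count, by induction on the size: the arrangements are sorted by their first letter
    [x], and deleting one [x] divides the product of factorials by [count_mem x s]. *)
Lemma size_permutations_fact (T : finType) (s : seq T) :
  (size (permutations s) * \prod_x (count_mem x s)`! = (size s)`!)%N.
Proof.
have [k] := ubnP (size s); elim: k s => // k IHk s; rewrite ltnS => le_sk.
have [-> | s_neq0] := eqVneq s [::].
  by rewrite big1 ?muln1.
rewrite (perm_size (permutationsE _)); last by case: s s_neq0 {le_sk}.
have -> : size (flatten [seq [seq x :: t | t <- permutations (rem x s)]
                          | x <- undup s])
  = (\sum_(x in s) size (permutations (rem x s)))%N.
  rewrite size_flatten /shape -map_comp sumnE big_map -[RHS]big_enum /=.
  under [LHS]eq_bigr do rewrite size_map.
  apply: perm_big; rewrite uniq_perm ?enum_uniq ?undup_uniq //.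
  by move=> x; rewrite mem_enum mem_undup.
have sum_count : (\sum_(x in s) count_mem x s = size s)%N.
  rewrite -[RHS]sum_count_mem big_mkcond; apply: eq_bigr => x _.
  by case: ifPn => // /count_memPn ->.
have sz_gt0 : (0 < size s)%N by rewrite lt0n size_eq0.
transitivity (\sum_(x in s) count_mem x s * (size s).-1`!)%N; last first.
  by rewrite -big_distrl /= sum_count; case: (size s) sz_gt0.
rewrite big_distrl /=; apply: eq_bigr => x xs.
have sz_rem := size_rem xs.
have lt_rem : (size (rem x s) < k)%N.
  by rewrite sz_rem; case: (size s) sz_gt0 le_sk.
rewrite -sz_rem -(IHk _ lt_rem) mulnCA; congr (_ * _)%N.
rewrite (bigD1 x) //= [in RHS](bigD1 x) //= mulnA; congr (_ * _)%N; last first.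
  apply: eq_bigr => y neq_yx; congr (_`!).
  by rewrite count_rem xs /= eq_sym (negPf neq_yx) subn0.
rewrite count_rem xs /= eqxx subn1.
have : (0 < count_mem x s)%N by rewrite -has_count has_pred1.
by case: (count_mem x s).
Qed.

(* A clone of a table is a function from pairs of indices in [I], with
   [#|I| = s], to the [m] by [n] blocks, which are here the points of an abstract
   type [T] with margins [row] and [col]. *)
Definition clones (I T D1 D2 : finType) (row : T -> D1 -> nat)
    (col : T -> D2 -> nat) (R : D1 -> nat) (C : D2 -> nat) :
    {set {ffun I * I -> T}} :=
  [set f : {ffun I * I -> T} | [forall a, forall i, \sum_b row (f (a, b)) i == #|I| * R i]
        && [forall b, forall j, \sum_a col (f (a, b)) j == #|I| * C j]]%N.

Lemma clonesP (I T D1 D2 : finType) (row : T -> D1 -> nat)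
    (col : T -> D2 -> nat) (R : D1 -> nat) (C : D2 -> nat)
    (f : {ffun I * I -> T}) :
  reflect ((forall a i, (\sum_b row (f (a, b)) i = #|I| * R i)%N) /\
           (forall b j, (\sum_a col (f (a, b)) j = #|I| * C j)%N))
          (f \in clones I row col R C).
Proof.
rewrite inE; apply: (iffP andP) => -[H1 H2]; split.
- by move=> a i; apply/eqP; move/forallP/(_ a)/forallP: H1.
- by move=> a i; apply/eqP; move/forallP/(_ a)/forallP: H2.
- by apply/forallP => a; apply/forallP => i; apply/eqP.
- by apply/forallP => a; apply/forallP => i; apply/eqP.
Qed.

(** Transport along a bijection of the index sets; this brings the sums and products of index types
    met below back to ordinals. *)
Lemma leq_card_clones (I J T D1 D2 : finType) (row : T -> D1 -> nat)
    (col : T -> D2 -> nat) (R : D1 -> nat) (C : D2 -> nat) :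
  #|I| = #|J| -> (#|clones I row col R C| <= #|clones J row col R C|)%N.
Proof.
move=> eqIJ; pose g (b : J) : I := enum_val (cast_ord (esym eqIJ) (enum_rank b)).
pose h (a : I) : J := enum_val (cast_ord eqIJ (enum_rank a)).
have gK : cancel g h.
  by move=> b; rewrite /g /h enum_valK cast_ordKV enum_rankK.
have hK : cancel h g.
  by move=> b; rewrite /g /h enum_valK cast_ordK enum_rankK.
have g_bij : bijective g by exists h.
pose F (f : {ffun I * I -> T}) : {ffun J * J -> T} :=
  [ffun q => f (g q.1, g q.2)].
rewrite -(card_imset (f := F)); last first.
  move=> f1 f2 /ffunP eqf; apply/ffunP => -[a b].
  by have := eqf (h a, h b); rewrite !ffunE /= !hK.
apply/subset_leq_card/fintype.subsetP => _ /imsetP[f /clonesP[fr fc] ->].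
apply/clonesP; split=> [a i | b j]; rewrite -eqIJ.
- rewrite -(fr (g a)) (reindex g) /=; last exact: onW_bij.
  by apply: eq_bigr => b _; rewrite ffunE.
- rewrite -(fc (g b)) (reindex g) /=; last exact: onW_bij.
  by apply: eq_bigr => a _; rewrite ffunE.
Qed.

(** A table over [I] fills one corner and copies of [t0] the other three quadrants; since [t0] has
    margins exactly [(R, C)], every line keeps the right average. *)
Lemma leq_card_clones_sum (I J T D1 D2 : finType) (row : T -> D1 -> nat)
    (col : T -> D2 -> nat) (R : D1 -> nat) (C : D2 -> nat) (t0 : T) :
    row t0 =1 R -> col t0 =1 C ->
  (#|clones I row col R C| <= #|clones (I + J)%type row col R C|)%N.
Proof.
move=> row_t0 col_t0.
pose F (f : {ffun I * I -> T}) : {ffun (I + J) * (I + J) -> T} :=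
  [ffun q => if q is (inl a, inl b) then f (a, b) else t0].
rewrite -(card_imset (f := F)); last first.
  move=> f1 f2 /ffunP eqf; apply/ffunP => -[a b].
  by have := eqf (inl a, inl b); rewrite !ffunE.
apply/subset_leq_card/fintype.subsetP => _ /imsetP[f /clonesP[fr fc] ->].
have sum_t0 (A : finType) k : (\sum_(a : A) k = #|A| * k)%N.
  by rewrite sum_nat_const.
apply/clonesP; split=> [a i | b j]; rewrite big_sumType card_sum mulnDl /=.
- case: a => a; do 2?[under eq_bigr do rewrite ffunE];
    do 2?[under [X in (_ + X)%N]eq_bigr do rewrite ffunE].
  + by rewrite fr row_t0 sum_t0.
  + by rewrite !row_t0 !sum_t0.
- case: b => b; do 2?[under eq_bigr do rewrite ffunE];
    do 2?[under [X in (_ + X)%N]eq_bigr do rewrite ffunE].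
  + by rewrite fc col_t0 sum_t0.
  + by rewrite !col_t0 !sum_t0.
Qed.

(* The blocks of the [J] by [J] table are taken from [X], the rows of those in
   column [v] being permuted by [p v] and the columns of those in row [u] by
   [q u]. *)
Lemma leq_card_clones_prod (I J T D1 D2 : finType) (row : T -> D1 -> nat)
    (col : T -> D2 -> nat) (R : D1 -> nat) (C : D2 -> nat)
    (X : {set {ffun I * I -> T}}) (rho : I -> D1 -> nat) (gamma : I -> D2 -> nat)
    (p q : J -> I -> I) :
    (forall f, f \in X -> forall a i, (\sum_b row (f (a, b)) i = rho a i)%N) ->
    (forall f, f \in X -> forall b j, (\sum_a col (f (a, b)) j = gamma b j)%N) ->
    (forall v, bijective (p v)) -> (forall u, bijective (q u)) ->
    (forall a i, (\sum_v rho (p v a) i = #|J| * #|I| * R i)%N) ->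
    (forall b j, (\sum_u gamma (q u b) j = #|J| * #|I| * C j)%N) ->
  (#|X| ^ (#|J| * #|J|) <= #|clones (J * I)%type row col R C|)%N.
Proof.
move=> Xr Xc p_bij q_bij sum_rho sum_gamma.
pose F (g : {ffun J * J -> {ffun I * I -> T}}) :
    {ffun (J * I) * (J * I) -> T} :=
  [ffun z => g (z.1.1, z.2.1) (p z.2.1 z.1.2, q z.1.1 z.2.2)].
rewrite -card_prod -card_ffun_on -(card_imset (f := F)); last first.
  move=> f1 f2 /ffunP eqf; apply/ffunP => -[u v]; apply/ffunP => -[a b].
  have [p' pK p'K] := p_bij v; have [q' qK q'K] := q_bij u.
  by have := eqf ((u, p' a), (v, q' b)); rewrite !ffunE /= p'K q'K.
apply/subset_leq_card/fintype.subsetP => _ /imsetP[f /ffun_onP fX ->].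
apply/clonesP; split=> [[u a] i | [v b] j]; rewrite card_prod.
- rewrite -(sum_rho a).
  under eq_bigr do rewrite ffunE /=.
  rewrite -(pair_bigA _ (fun v b => row (f (u, v) (p v a, q u b)) i)) /=.
  apply: eq_bigr => v _; rewrite -(Xr (f (u, v))) // [RHS](reindex (q u)) //=.
  exact: onW_bij.
- rewrite -(sum_gamma b).
  under eq_bigr do rewrite ffunE /=.
  rewrite -(pair_bigA _ (fun u a => col (f (u, v) (p v a, q u b)) j)) /=.
  apply: eq_bigr => u _; rewrite -(Xc (f (u, v))) // [RHS](reindex (p v)) //=.
  exact: onW_bij.
Qed.

(** Clones of order [r] are placed freely in a square pattern of side [s %/ r], and the remaining
    [s %% r] lines are padded with [t0]. *)
Lemma leq_card_clones_divn (T D1 D2 : finType) (row : T -> D1 -> nat)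
    (col : T -> D2 -> nat) (R : D1 -> nat) (C : D2 -> nat) (t0 : T) (r s : nat) :
    row t0 =1 R -> col t0 =1 C ->
  (#|clones 'I_r row col R C| ^ (s %/ r) ^ 2 <= #|clones 'I_s row col R C|)%N.
Proof.
move=> row_t0 col_t0.
have prod_bnd : (#|clones 'I_r row col R C| ^ (s %/ r) ^ 2 <=
    #|clones ('I_(s %/ r) * 'I_r)%type row col R C|)%N.
  rewrite -mulnn -[X in (X * X)%N]card_ord.
  apply: (leq_card_clones_prod (rho := fun=> fun i => (#|'I_r| * R i)%N)
    (gamma := fun=> fun j => (#|'I_r| * C j)%N)
    (p := fun=> id) (q := fun=> id)).
  - by move=> f /clonesP[].
  - by move=> f /clonesP[].
  - by move=> _; exists id.
  - by move=> _; exists id.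
  - by move=> a i; rewrite sum_nat_const mulnA.
  - by move=> b j; rewrite sum_nat_const mulnA.
apply: leq_trans prod_bnd _.
apply: leq_trans (leq_card_clones_sum _ 'I_(s %% r) row_t0 col_t0) _.
by apply: leq_card_clones; rewrite card_sum card_prod !card_ord -divn_eq.
Qed.

(* Only the [m + n] margins of the sum of all the blocks are prescribed. *)
Definition total_clones (I T D1 D2 : finType) (row : T -> D1 -> nat)
    (col : T -> D2 -> nat) (R : D1 -> nat) (C : D2 -> nat) :
    {set {ffun I * I -> T}} :=
  [set f : {ffun I * I -> T} | [forall i, \sum_q row (f q) i == #|I| * #|I| * R i]
        && [forall j, \sum_q col (f q) j == #|I| * #|I| * C j]]%N.

(* Pigeonhole: some family [X] of tables shares all its individual margins;
   translating these tables cyclically in the blocks of a larger table makes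
   every margin of the latter the average of the margins of [X]. *)
Lemma leq_card_total_clones (T D1 D2 : finType) (row : T -> D1 -> nat)
    (col : T -> D2 -> nat) (R : D1 -> nat) (C : D2 -> nat) (B s : nat) :
    (0 < s)%N ->
    (forall t i, (row t i <= B)%N) -> (forall t j, (col t j <= B)%N) ->
  exists2 x : nat,
    (#|total_clones 'I_s row col R C| <=
       x * (s * B).+1 ^ (s * (#|D1| + #|D2|)))%N &
    (x ^ s ^ 2 <= #|clones 'I_(s ^ 2) row col R C|)%N.
Proof.
case: s => // s _ le_rowB le_colB; set W := total_clones _ _ _ _ _.
pose M := {ffun 'I_s.+1 * (D1 + D2) -> 'I_(s.+1 * B).+1}.
pose margin (f : {ffun 'I_s.+1 * 'I_s.+1 -> T}) : M :=
  [ffun z => match z.2 with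
             | inl i => inord (\sum_b row (f (z.1, b)) i)
             | inr j => inord (\sum_a col (f (a, z.1)) j)
             end].
pose X (y : M) := [set f in W | margin f == y].
have card_W : #|W| = (\sum_y #|X y|)%N.
  rewrite -sum1_card (partition_big margin predT) //=; apply: eq_bigr => y _.
  by rewrite -[RHS]sum1_card; apply: eq_bigl => f; rewrite [in RHS]inE.
pose y0 : M := [ffun=> ord0].
case: (@arg_maxnP M y0 predT (fun y => #|X y|) isT) => y _ max_y.
exists #|X y|.
  apply: (@leq_trans (\sum_(z : M) #|X y|)).
    by rewrite card_W; apply: leq_sum => z _; exact: max_y.
  rewrite sum_nat_const card_ffun card_prod card_sum !card_ord mulnC.
  exact: leqnn.
have sum_bound : (s.+1 * B = \sum_(a < s.+1) B)%N.
  by rewrite sum_nat_const card_ord.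
have row_lt (f : {ffun 'I_s.+1 * 'I_s.+1 -> T}) a i : (\sum_b row (f (a, b)) i < (s.+1 * B).+1)%N.
  by rewrite ltnS sum_bound; apply: leq_sum => c _; rewrite ?le_rowB ?le_colB.
have col_lt (f : {ffun 'I_s.+1 * 'I_s.+1 -> T}) b j : (\sum_a col (f (a, b)) j < (s.+1 * B).+1)%N.
  by rewrite ltnS sum_bound; apply: leq_sum => c _; rewrite ?le_rowB ?le_colB.
have Xr f : f \in X y -> forall a i, (\sum_b row (f (a, b)) i = y (a, inl i))%N.
  rewrite inE => /andP[_ /eqP <-] a i.
  by rewrite ffunE /= inordK ?row_lt.
have Xc f : f \in X y -> forall b j, (\sum_a col (f (a, b)) j = y (b, inr j))%N.
  rewrite inE => /andP[_ /eqP <-] a i.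
  by rewrite ffunE /= inordK ?col_lt.
(* If even the largest class is empty, the bound is trivial; otherwise any member [f] shows that the
   common margins [y] average to [(R, C)]. *)
have [X0 | [f fX]] := set_0Vmem (X y); first by rewrite X0 cards0 exp0n ?expn_gt0.
have : f \in W by move: fX; rewrite inE => /andP[].
rewrite inE => /andP[/forallP fr /forallP fc].
have sum_r i : (\sum_a y (a, inl i) = #|'I_s.+1| * #|'I_s.+1| * R i)%N.
  rewrite -(eqP (fr i)) (eq_bigr _ (fun a _ => esym (Xr f fX a i))).
  by rewrite pair_bigA /=; apply: eq_bigr => -[].
have sum_c j : (\sum_b y (b, inr j) = #|'I_s.+1| * #|'I_s.+1| * C j)%N.
  rewrite -(eqP (fc j)) (eq_bigr _ (fun b _ => esym (Xc f fX b j))).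
  by rewrite exchange_big pair_bigA /=; apply: eq_bigr => -[].
have shift_bij (v : 'I_s.+1) : bijective (fun a => (a + v)%R).
  by exists (fun a => (a - v)%R) => a; rewrite ?addrK ?subrK.
have bnd : (#|X y| ^ (s.+1 ^ 2) <=
    #|clones ('I_s.+1 * 'I_s.+1)%type row col R C|)%N.
  rewrite -[X in (_ ^ (X ^ 2))%N]card_ord -mulnn.
  apply: (leq_card_clones_prod (p := fun v a => (a + v)%R)
    (q := fun u b => (b + u)%R) Xr Xc) => //.
  - move=> a i; rewrite -sum_r [RHS](reindex (fun v => (v + a)%R)).
      by apply: eq_bigr => v _; rewrite addrC.
    exact: onW_bij.
  - move=> a i; rewrite -sum_c [RHS](reindex (fun v => (v + a)%R)).
      by apply: eq_bigr => v _; rewrite addrC.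
    exact: onW_bij.
apply: leq_trans bnd _.
by apply: leq_card_clones; rewrite card_prod !card_ord mulnn.
Qed.

(** Distinct arrangements of [t] over the cells are distinct tables, and total margins depend only
    on the multiset of letters. *)
Lemma leq_size_permutations (I T D1 D2 : finType) (row : T -> D1 -> nat)
    (col : T -> D2 -> nat) (R : D1 -> nat) (C : D2 -> nat) (t : seq T) :
    size t = (#|I| * #|I|)%N ->
    (forall i, (\sum_(x <- t) row x i = #|I| * #|I| * R i)%N) ->
    (forall j, (\sum_(x <- t) col x j = #|I| * #|I| * C j)%N) ->
  (size (permutations t) <= #|total_clones I row col R C|)%N.
Proof.
case: t => [|t0 t].
  move=> /esym/eqP; rewrite muln_eq0 orbb => /eqP I0 _ _.
  rewrite /= card_gt0; apply/set0Pn.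
  have I0P (a : I) : False by exact: (fintype0 a I0).
  exists [ffun q => match I0P q.1 with end].
  by rewrite inE I0; apply/andP; split; apply/forallP => i;
    rewrite big1 // => -[a]; case: (I0P a).
set u := t0 :: t => sz_u ur uc.
pose F (z : seq T) : {ffun I * I -> T} := [ffun q => nth t0 z (enum_rank q)].
have sz z : z \in permutations u -> size z = #|{: I * I}|.
  by rewrite mem_permutations => /perm_size ->; rewrite sz_u card_prod.
have F_inj : {in permutations u &, injective F}.
  move=> z1 z2 /sz sz1 /sz sz2 /ffunP eqF.
  apply: (@eq_from_nth _ t0); rewrite ?sz1 // => i lti.
  by have := eqF (enum_val (Ordinal lti)); rewrite !ffunE enum_valK.
rewrite -(size_map F) -(card_uniqP _); last first.
  by rewrite map_inj_in_uniq ?permutations_uniq.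
apply/subset_leq_card/fintype.subsetP => _ /mapP[z zu ->].
have sumF (G : T -> nat) : (\sum_q G (F z q) = \sum_(x <- u) G x)%N.
  transitivity (\sum_(x <- z) G x)%N; last first.
    by apply: perm_big; rewrite -mem_permutations.
  rewrite (big_nth t0) (sz z zu) big_mkord /=.
  rewrite (reindex (@enum_rank (I * I)%type)) /=; last exact/onW_bij/enum_rank_bij.
  by apply: eq_bigr => q _; rewrite ffunE.
rewrite inE; apply/andP; split; apply/forallP => i.
- by rewrite (sumF (row^~ i)) ur.
- by rewrite (sumF (col^~ i)) uc.
Qed.

Local Open Scope classical_set_scope.
Local Open Scope ring_scope.

(** * Entropy of rational types *)

Lemma ln_le_subr1 (F : realType) (x : F) : 0 < x -> ln x <= x - 1.
Proof.
move=> x_gt0; have := @le_ln1Dx F (x - 1).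
by rewrite addrCA subrr addr0; apply; lra.
Qed.

Lemma ln_ge_1subV (F : realType) (x : F) : 0 < x -> 1 - x^-1 <= ln x.
Proof.
move=> x_gt0; have := @ln_le_subr1 F x^-1.
rewrite invr_gt0 => /(_ x_gt0); rewrite lnV ?posrE //; lra.
Qed.

Lemma ln_prod (F : realType) (I : finType) (f : I -> F) :
  (forall i, 0 < f i) -> ln (\prod_i f i) = \sum_i ln (f i).
Proof.
move=> f_gt0.
suff [] : 0 < \prod_i f i /\ ln (\prod_i f i) = \sum_i ln (f i) by [].
apply: (big_ind2 (fun x y => 0 < x /\ ln x = y)) => [|x1 x2 y1 y2|i _] //.
  by rewrite ln1.
by move=> [x1_gt0 <-] [y1_gt0 <-]; rewrite mulr_gt0 // lnM.
Qed.

Lemma natr_ln_step (F : realType) (n : nat) :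
  n%:R * (ln n.+1%:R - ln n%:R) <= 1 :> F.
Proof.
have [->|n_gt0] := posnP n; first by rewrite mul0r.
have n1_gt0 : 0 < n.+1%:R :> F by rewrite ltr0n.
have n_gt0' : 0 < n%:R :> F by rewrite ltr0n.
have : ln (n.+1%:R / n%:R : F) <= n.+1%:R / n%:R - 1.
  by apply: ln_le_subr1; rewrite divr_gt0.
rewrite ln_div ?posrE // => step.
apply: (le_trans (ler_wpM2l (ltW n_gt0') step)).
by rewrite mulrBr mulrCA divff ?gt_eqF // !mulr1 -natr1; lra.
Qed.

Lemma ln_fact_ge (F : realType) (n : nat) :
  n%:R * ln n%:R - n%:R <= ln n`!%:R :> F.
Proof.
elim: n => [|n IHn]; first by rewrite mul0r subr0 ln1.
rewrite factS natrM lnM ?posrE ?ltr0n ?fact_gt0 //.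
have step2 := natr_ln_step F n.
rewrite -natr1 in step2 *; lra.
Qed.

Lemma ln_fact_le (F : realType) (n : nat) :
  ln n`!%:R <= n%:R * ln n%:R - n%:R + ln n.+1%:R + 1 :> F.
Proof.
(* The induction goes through in this form; replacing [ln n.+1] by [ln n] in [n * ln n.+1] then
   costs at most 1. *)
have main : ln n`!%:R <= n.+1%:R * ln n.+1%:R - n%:R :> F.
  elim: n => [|n IHn]; first by rewrite ln1; lra.
  rewrite factS natrM lnM ?posrE ?ltr0n ?fact_gt0 //.
  have n1_gt0 : 0 < n.+1%:R :> F by rewrite ltr0n.
  have n2_gt0 : 0 < n.+2%:R :> F by rewrite ltr0n.
  have : 1 - (n.+2%:R / n.+1%:R)^-1 <= ln (n.+2%:R / n.+1%:R : F).
    by apply: ln_ge_1subV; rewrite divr_gt0.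
  rewrite ln_div ?posrE // invf_div => step.
  have step2 : 1 <= n.+2%:R * (ln n.+2%:R - ln n.+1%:R) :> F.
    apply: le_trans (ler_wpM2l (ltW n2_gt0) step).
    by rewrite mulrBr mulrCA divff ?gt_eqF // !mulr1 -[n.+2%:R]natr1; lra.
  rewrite -[n.+2%:R]natr1 -[n.+1%:R]natr1 in step2 IHn *; lra.
have step2 := natr_ln_step F n.
rewrite -natr1 in step2 main *; lra.
Qed.

(** The summand of Shannon's entropy; the factor [x] makes it vanish at 0, whatever the value of
    [ln 0]. *)
Definition eta (F : realType) (x : F) : F := - (x * ln x).

(** The words of type [n / N] and length [k * N] are counted by a multinomial coefficient; the
    factorial bounds turn its logarithm into length times entropy, up to a logarithmic error per
    letter. *)
Lemma ln_size_permutations (F : realType) (T : finType) (s : seq T) (N k : nat)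
    (n : T -> nat) :
    (0 < N)%N -> (0 < k)%N -> (\sum_x n x = N)%N ->
    (forall x, count_mem x s = k * n x)%N ->
  (k * N)%:R * \sum_x eta ((n x)%:R / N%:R) - #|T|%:R * (ln (k * N).+1%:R + 1)
    <= ln (size (permutations s))%:R :> F.
Proof.
move=> N_gt0 k_gt0 sum_n count_s.
have sz_s : size s = (k * N)%N.
  by rewrite -sum_count_mem -sum_n big_distrr /=; apply: eq_bigr.
have := congr1 (fun m => ln (m%:R : F)) (size_permutations_fact s).
have perm_gt0 : (0 < size (permutations s))%N.
  by move: (fact_gt0 (size s)); rewrite -size_permutations_fact muln_gt0 => /andP[].
rewrite natrM lnM ?posrE ?ltr0n ?prodn_gt0 //; last by move=> x; exact: fact_gt0.
rewrite natr_prod ln_prod; last by move=> x; rewrite ltr0n fact_gt0.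
rewrite sz_s => /(canRL (addrK _)) ->.
have lnN x : (k * n x)%:R * ln (k * n x)%:R =
    - (k * N)%:R * eta ((n x)%:R / N%:R) + (k * n x)%:R * ln (k * N)%:R :> F.
  have [->|nx_gt0] := posnP (n x); first by rewrite muln0 /eta !mul0r oppr0 mulr0 addr0.
  rewrite /eta ln_div ?posrE ?ltr0n // !natrM !lnM ?posrE ?ltr0n //.
  by field; rewrite pnatr_eq0 -lt0n.
(* The constant is kept opaque, as a single term when the sums are split. *)
have [c c_def] : exists c : F, c = ln (k * N).+1%:R + 1 by eexists.
have bnd : \sum_x ln (count_mem x s)`!%:R <=
    \sum_x (- (k * N)%:R * eta ((n x)%:R / N%:R) + (k * n x)%:R * ln (k * N)%:R
       - (k * n x)%:R + c) :> F.
  apply: ler_sum => x _; rewrite count_s.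
  apply: le_trans (ln_fact_le _ _) _; rewrite lnN c_def -!addrA !lerD2l lerD2r.
  rewrite ler_ln ?posrE ?ltr0n // ler_nat ltnS leq_mul2l -sum_n.
  by rewrite (bigD1 x) //= leq_addr orbT.
have sum_kn : \sum_x (k * n x)%:R = (k * N)%:R :> F.
  by rewrite -sum_n big_distrr natr_sum.
move: bnd; rewrite !big_split /= sumrN -mulr_sumr -mulr_suml sum_kn.
rewrite sumr_const -[X in _ + X]mulr_natl -c_def.
have := ln_fact_ge F (k * N); rewrite mulNr; lra.
Qed.

(** Pigeonhole: among the [Q ^ #|T| + 1] multiples [k * p], two have their fractional parts in the
    same box of side [1 / Q], and [N] is the difference of their multipliers. *)
Lemma dirichlet_approximation (F : realType) (T : finType) (p : T -> F) (Q : nat) :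
    (0 < Q)%N -> (forall x, 0 <= p x) ->
  exists N : nat, exists n : T -> nat,
    [/\ (0 < N)%N, (N <= Q ^ #|T|)%N &
        forall x, `|N%:R * p x - (n x)%:R| <= Q%:R^-1].
Proof.
move=> Q_gt0 p_ge0; have Q_gt0' : 0 < Q%:R :> F by rewrite ltr0n.
pose fl (k : nat) x := Num.trunc (k%:R * p x).
have kp_ge0 k x : 0 <= k%:R * p x by rewrite mulr_ge0.
pose fr k x := k%:R * p x - (fl k x)%:R.
have fr_itv k x : 0 <= fr k x < 1.
  have /andP[] := truncn_itv (kp_ge0 k x).
  by rewrite /fr /fl -natr1 subr_ge0 ltrBlDr addrC => -> ->.
have box_lt k x : (Num.trunc (Q%:R * fr k x) < Q)%N.
  have /andP[fr0 fr1] := fr_itv k x.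
  by rewrite truncn_lt_nat ?mulr_ge0 // gtr_pMr.
pose box (k : 'I_(Q ^ #|T|).+1) : {ffun T -> 'I_Q} := [ffun x => Ordinal (box_lt k x)].
have /injectivePn[k1 [k2 neq12 eq12]] : ~~ injectiveb box.
  apply/negP => /injectiveP/leq_card.
  by rewrite card_ffun !card_ord ltnn.
wlog lt12 : k1 k2 neq12 eq12 / (k1 < k2)%N.
  move=> W; case: (ltngtP k1 k2) => [|lt21|/val_inj eqk]; first exact: W.
    by apply: (W k2 k1); rewrite // eq_sym.
  by rewrite eqk eqxx in neq12.
(* These truncated subtractions lose nothing: as [p >= 0], the integer parts increase with [k]. *)
exists (k2 - k1)%N; exists (fun x => fl k2 x - fl k1 x)%N; split.
- by rewrite subn_gt0.
- by rewrite (leq_trans (leq_subr _ _)) // -ltnS.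
move=> x; have le_fl : (fl k1 x <= fl k2 x)%N.
  by apply: le_truncn; rewrite ler_wpM2r // ler_nat ltnW.
rewrite !natrB ?(ltnW lt12) //.
have -> : (k2%:R - k1%:R) * p x - ((fl k2 x)%:R - (fl k1 x)%:R) =
  fr k2 x - fr k1 x by rewrite /fr; ring.
have eqt : Num.trunc (Q%:R * fr k1 x) = Num.trunc (Q%:R * fr k2 x).
  by move/ffunP/(_ x): eq12; rewrite !ffunE => -[].
have /andP[f1 _] := fr_itv k1 x; have /andP[f2 _] := fr_itv k2 x.
have /andP[] := truncn_itv (mulr_ge0 (ltW Q_gt0') f1).
have /andP[] := truncn_itv (mulr_ge0 (ltW Q_gt0') f2).
rewrite eqt -natr1; set c := (Num.trunc _)%:R => l2 u2 l1 u1.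
rewrite -(ler_pM2l Q_gt0') divff ?gt_eqF // -[X in X * _]gtr0_norm //.
by rewrite -normrM mulrBr ler_norml; apply/andP; split; lra.
Qed.

(** The slope of [eta] is infinite at 0. For [n = 0] the squared accuracy makes up for it; for
    [n > 0] the slope at [n / N] is at most [N] in absolute value, which the factor [N] in the
    hypothesis on [x] pays for. *)
Lemma eta_rational_approx (F : realType) (x : F) (N n q : nat) :
    (0 < N)%N -> (n <= N)%N -> (0 < q)%N -> 0 <= x ->
    `|N%:R * x - n%:R| <= (q ^ 2)%:R^-1 ->
  eta x - 2 / q%:R <= eta (n%:R / N%:R).
Proof.
move=> N_gt0 le_nN q_gt0 x_ge0 close.
have q_gt0' : 0 < q%:R :> F by rewrite ltr0n.
have N_gt0' : 0 < N%:R :> F by rewrite ltr0n.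
have N_ge1 : 1 <= N%:R :> F by rewrite ler1n.
have q_ge1 : 1 <= q%:R :> F by rewrite ler1n.
have iq_gt0 : 0 < q%:R^-1 :> F by rewrite invr_gt0.
have iq_le1 : q%:R^-1 <= 1 :> F by rewrite invf_le1.
have eq2 : (q ^ 2)%:R^-1 = q%:R^-1 ^+ 2 :> F by rewrite natrX exprVn.
rewrite eq2 in close.
move: x_ge0; rewrite le_eqVlt => /predU1P[<-|x_gt0].
  rewrite /eta mul0r oppr0 sub0r.
  have y_ge0 : 0 <= n%:R / N%:R :> F by rewrite divr_ge0.
  apply: (@le_trans _ _ 0); first by rewrite oppr_le0 mulr_ge0 // ltW.
  rewrite -mulrN mulr_ge0 // oppr_ge0 ln_le0 //.
  by rewrite ler_pdivrMr // mul1r ler_nat.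
have [n0|n_gt0] := posnP n.
  rewrite n0 mul0r /eta mul0r oppr0.
  move: close; rewrite n0 subr0 gtr0_norm ?mulr_gt0 // => close.
  have x_le : x <= q%:R^-1 ^+ 2.
    by apply: le_trans close; rewrite ler_peMl // ltW.
  (* With [x = r ^+ 2] and [r <= 1 / q], [eta x = 2 * r ^+ 2 * ln (1 / r) <= 2 * r]. *)
  have [r r_gt0 xE] : exists2 r, 0 < r & x = r ^+ 2.
    by exists (Num.sqrt x); rewrite ?sqrtr_gt0 // sqr_sqrtr // ltW.
  have r_le : r <= q%:R^-1.
    by rewrite -ler_sqr ?nnegrE ?(ltW r_gt0) ?(ltW iq_gt0) // -xE.
  have : ln r^-1 <= r^-1 - 1 by apply: ln_le_subr1; rewrite invr_gt0.
  rewrite lnV ?posrE // => /(ler_wpM2l (exprn_ge0 2 (ltW r_gt0))).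
  have -> : r ^+ 2 * (r^-1 - 1) = r - r ^+ 2.
    by rewrite mulrBr mulr1 {1}expr2 mulfK ?gt_eqF.
  have := sqr_ge0 r; rewrite xE lnXn // -mulr_natl; lra.
have n_gt0' : 0 < n%:R :> F by rewrite ltr0n.
set y := n%:R / N%:R.
have y_gt0 : 0 < y by rewrite divr_gt0.
have y_le1 : y <= 1 by rewrite ler_pdivrMr // mul1r ler_nat.
have lny_le0 : ln y <= 0 by exact: ln_le0.
have lny_ge : - (N%:R - 1) <= ln y.
  have : ln y^-1 <= N%:R - 1.
    apply: le_trans (ln_le_subr1 _) _; rewrite ?invr_gt0 // lerD2r.
    rewrite invf_div ler_pdivrMr // ler_peMr ?ler1n // ltW.
  by rewrite lnV ?posrE //; lra.
(* The graph of the concave [eta] lies below its tangent at [y]. *)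
have concave : eta x <= eta y + (y - x) * (ln y + 1).
  have : ln (y / x) <= y / x - 1 by apply: ln_le_subr1; rewrite divr_gt0.
  rewrite ln_div ?posrE // => /(ler_wpM2l (ltW x_gt0)).
  rewrite [leRHS]mulrBr mulr1 mulrCA divff ?gt_eqF // /eta; lra.
have err : (y - x) * (ln y + 1) <= q%:R^-1 ^+ 2.
  apply: le_trans (ler_norm _) _; rewrite normrM.
  have lnb : `|ln y + 1| <= N%:R by rewrite ler_norml; apply/andP; split; lra.
  apply: le_trans (ler_wpM2l (normr_ge0 _) lnb) _.
  rewrite -[X in _ * X <= _]gtr0_norm // -normrM mulrBl divfK ?gt_eqF //.
  by rewrite distrC mulrC.
have : q%:R^-1 ^+ 2 <= q%:R^-1 :> F by rewrite expr2 ger_pMl.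
lra.
Qed.

(** * Gibbs distributions *)

Lemma finite_family_bounded (F : realType) (T D : finType) (u : T -> D -> F) :
  exists2 U, 1 <= U & forall t d, `|u t d| <= U.
Proof.
exists (1 + \sum_t \sum_d `|u t d|) => [|t d].
  by rewrite lerDl sumr_ge0 // => t _; exact: sumr_ge0.
rewrite (bigD1 t) //= (bigD1 d) //=.
have : 0 <= \sum_(i | i != d) `|u t i| by apply: sumr_ge0.
have : 0 <= \sum_(i | i != t) \sum_j `|u i j|.
  by apply: sumr_ge0 => s _; exact: sumr_ge0.
lra.
Qed.

(** From [1 - x <= expR (- x)] comes [(1 - x) * expR x <= 1], and the quadratic times [1 - x] is at
    least 1. *)
Lemma expR_le_quadratic (F : realType) (x : F) :
  `|x| <= 2^-1 -> expR x <= 1 + x + 2 * x ^+ 2.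
Proof.
rewrite ler_norml => /andP[x_ge x_le].
have x1_gt0 : 0 < 1 - x by lra.
have le1 : (1 - x) * expR x <= 1.
  have := expR_ge1Dx (- x); rewrite -(ler_pM2r (expR_gt0 x)).
  by rewrite -expRD addNr expR0.
rewrite -(ler_pM2l x1_gt0); apply: le_trans le1 _.
have -> : (1 - x) * (1 + x + 2 * x ^+ 2) = 1 + x ^+ 2 * (1 - 2 * x) by ring.
by rewrite lerDl mulr_ge0 ?sqr_ge0 //; lra.
Qed.

(** An approximate minimizer suffices for the Gibbs distribution, so only the infimum is called on,
    not compactness. *)
Lemma regularized_minimizer (F : realType) (D : finType) (J : (D -> F) -> F)
    (d : F) :
    0 < d -> (forall th, 0 <= J th) ->
  exists th, forall th', J th <= J th' + d.
Proof.
move=> d_gt0 J_ge0; pose E : set F := range J.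
have E_inf : has_inf E.
  split; first by exists (J (fun=> 0)); exists (fun=> 0).
  by exists 0 => _ [th _ <-].
have [_ [th _ <-] lt_th] := inf_adherent d_gt0 E_inf.
exists th => th'; apply/ltW/(lt_le_trans lt_th); rewrite lerD2r.
by apply: ge_inf; [exact: E_inf.2 | exists th'].
Qed.

(** The ratio of the two partition functions is the mean of [expR (c * u t d0)] under the Gibbs
    distribution [p]. The quadratic bound on [expR], then [ln z <= z - 1], leave the derivative,
    which is the mean of [u], and a second-order error. *)
Lemma ln_sum_expR_perturb (F : realType) (T D : finType) (u : T -> D -> F)
    (U : F) (th : D -> F) (d0 : D) (c : F) (p : T -> F) :
    (forall t d, `|u t d| <= U) -> `|c| * U <= 2^-1 ->
    (0 < \sum_t expR (\sum_d th d * u t d)) ->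
    (forall t, p t = expR (\sum_d th d * u t d) /
                     \sum_t expR (\sum_d th d * u t d)) ->
  ln (\sum_t expR (\sum_d (th d + (d == d0)%:R * c) * u t d)) <=
  ln (\sum_t expR (\sum_d th d * u t d)) +
    c * (\sum_t p t * u t d0) + 2 * c ^+ 2 * U ^+ 2.
Proof.
move=> u_le cU; set E := \sum_t expR _ => E_gt0 pE.
have p_ge0 t : 0 <= p t by rewrite pE divr_ge0 ?expR_ge0 ?ltW.
have sum_p : \sum_t p t = 1.
  by under eq_bigr do rewrite pE; rewrite -mulr_suml divff ?gt_eqF.
have -> : \sum_t expR (\sum_d (th d + (d == d0)%:R * c) * u t d) =
          E * \sum_t p t * expR (c * u t d0).
  rewrite mulr_sumr; apply: eq_bigr => t _.
  rewrite pE mulrA mulrCA divff ?gt_eqF // mulr1 -expRD; congr expR.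
  under eq_bigr do rewrite mulrDl; rewrite big_split /=; congr (_ + _).
  rewrite (bigD1 d0) //= eqxx mul1r big1 ?addr0 // => d /negPf ->.
  by rewrite !mul0r.
have bnd : \sum_t p t * expR (c * u t d0) <=
    1 + c * (\sum_t p t * u t d0) + 2 * c ^+ 2 * U ^+ 2.
  apply: (@le_trans _ _ (\sum_t (p t + c * (p t * u t d0) +
                                 2 * c ^+ 2 * U ^+ 2 * p t))); last first.
    by rewrite !big_split /= -!mulr_sumr sum_p mulr1.
  apply: ler_sum => t _.
  have cu_le : `|c * u t d0| <= 2^-1.
    by rewrite normrM (le_trans _ cU) // ler_wpM2l.
  apply: le_trans (ler_wpM2l (p_ge0 t) (expR_le_quadratic cu_le)) _.
  have -> : p t * (1 + c * u t d0 + 2 * (c * u t d0) ^+ 2) =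
     p t + c * (p t * u t d0) + 2 * c ^+ 2 * (u t d0) ^+ 2 * p t by ring.
  rewrite lerD2l; apply: ler_wpM2r => //.
  apply: ler_wpM2l; first by rewrite mulr_ge0 ?sqr_ge0.
  rewrite -(real_normK (num_real (u t d0))) ler_sqr ?nnegrE //.
  exact: le_trans (u_le t d0).
have S_gt0 : 0 < \sum_t p t * expR (c * u t d0).
  rewrite lt_neqAle sumr_ge0 ?andbT; last first.
    by move=> t _; rewrite mulr_ge0 ?expR_ge0.
  rewrite eq_sym psumr_neq0; last by move=> t _; rewrite mulr_ge0 ?expR_ge0.
  have : \sum_t p t != 0 by rewrite sum_p oner_neq0.
  rewrite psumr_neq0 // => /hasP[t tin /= p_gt0].
  by apply/hasP; exists t => //=; rewrite mulr_gt0 ?expR_gt0.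
rewrite lnM ?posrE // -addrA lerD2l.
apply: le_trans (ln_le_subr1 S_gt0) _; lra.
Qed.

(* The Gibbs distribution at an approximate minimizer [th] of the log-partition
   function plus [k^2/2 |th|^2]; the regularization keeps [k |th|] bounded, so
   that both the mean and the entropy defect are [O(k)]. *)
Lemma gibbs_distribution (F : realType) (T D : finType) (u : T -> D -> F)
    (t0 : T) (phi e : F) :
    (forall d, u t0 d = 0) ->
    (forall th : D -> F, phi <= ln (\sum_t expR (\sum_d th d * u t d))) ->
    0 < e ->
  exists p : T -> F,
    [/\ forall t, 0 <= p t, \sum_t p t = 1,
        forall d, `|\sum_t p t * u t d| <= e &
        phi - e <= \sum_t eta (p t)].
Proof.
move=> u_t0 le_phi e_gt0.
have [U U_ge1 u_le] := finite_family_bounded u.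
pose E th : F := \sum_t expR (\sum_d th d * u t d).
(* The term of [t0] is 1, so the log-partition function is nonnegative and the objective [J] below
   is bounded below. *)
have E_ge1 th : 1 <= E th.
  rewrite /E (bigD1 t0) //= [\sum_d _]big1 => [|d _]; last first.
    by rewrite u_t0 mulr0.
  by rewrite expR0 lerDl; apply: sumr_ge0 => t _; exact: expR_ge0.
have E_gt0 th : 0 < E th by apply: lt_le_trans (E_ge1 th).
pose L : F := ln (E (fun=> 0)).
have L_ge0 : 0 <= L by exact: ln_ge0.
(* [M] will bound [k * |th d|], by comparing [J] at [th] and at 0; [C] will bound the approximate
   gradient divided by [dl]. *)
pose M : F := 2 * (L + 1).
have M_ge1 : 1 <= M by rewrite /M; lra.
have M_ge0 : 0 <= M by lra.
pose C : F := 2 * U ^+ 2 + 2.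
have C_ge0 : 0 <= C by rewrite /C; have := sqr_ge0 U; lra.
(* Chosen so that [k = 1 / A] is small enough for the quadratic bound ([kU]) and for all the final
   errors ([kX]). *)
pose A : F := 2 * U + (C + M + #|D|%:R * M * C) / e.
have X_ge0 : 0 <= C + M + #|D|%:R * M * C.
  by rewrite !addr_ge0 ?mulr_ge0 //; lra.
have A_gt0 : 0 < A by rewrite /A; have := divr_ge0 X_ge0 (ltW e_gt0); lra.
pose k : F := A^-1.
have k_gt0 : 0 < k by rewrite invr_gt0.
have kA : k * A = 1 by rewrite /k mulVf ?gt_eqF.
have kU : k * U <= 2^-1.
  have : k * (2 * U) <= k * A.
    by rewrite ler_pM2l // /A lerDl divr_ge0 // ltW.
  rewrite kA; lra.
have kX : k * (C + M + #|D|%:R * M * C) <= e.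
  have : k * ((C + M + #|D|%:R * M * C) / e) <= k * A.
    by rewrite ler_pM2l // /A lerDr mulr_ge0 //; lra.
  by rewrite kA mulrA ler_pdivrMr // mul1r.
have k_le1 : k <= 1.
  apply: (@le_trans _ _ (k * U)); last by lra.
  by rewrite ler_pMr.
pose dl : F := k ^+ 2.
have dl_gt0 : 0 < dl by rewrite exprn_gt0.
have dl_lek : dl <= k by rewrite /dl expr2 ger_pMl.
pose J th : F := ln (E th) + dl / 2 * \sum_d th d ^+ 2.
have J_ge0 th : 0 <= J th.
  rewrite addr_ge0 ?ln_ge0 // mulr_ge0 //; first by rewrite divr_ge0 // ltW.
  by apply: sumr_ge0 => d _; exact: sqr_ge0.
have [th min_th] := regularized_minimizer (exprn_gt0 2 dl_gt0) J_ge0.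
have sum_sq_ge0 : 0 <= \sum_d th d ^+ 2 by apply: sumr_ge0 => d _; exact: sqr_ge0.
have th_le d : k * `|th d| <= M.
  have dl2 : dl ^+ 2 <= 1 by rewrite exprn_ile1 ?(ltW dl_gt0) ?(le_trans dl_lek).
  have : J th <= L + 1.
    apply: le_trans (min_th (fun=> 0)) _; rewrite /J -/L.
    by rewrite big1 ?mulr0 ?addr0 ?lerD2l // => ? _; rewrite expr0n.
  have sq_le : th d ^+ 2 <= \sum_d th d ^+ 2.
    by rewrite (bigD1 d) //= lerDl sumr_ge0 // => ? _; exact: sqr_ge0.
  have := ln_ge0 (E_ge1 th); rewrite /J => h1 h2.
  have h3 : dl * \sum_d th d ^+ 2 <= M by rewrite /M; lra.
  have h4 : (k * `|th d|) ^+ 2 <= M ^+ 2.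
    rewrite exprMn -normrX (ger0_norm (sqr_ge0 _)) -/dl.
    apply: (@le_trans _ _ M); last by rewrite expr2 ler_pMl // (lt_le_trans _ M_ge1).
    by apply: le_trans h3; rewrite ler_pM2l.
  by rewrite -ler_sqr ?nnegrE // mulr_ge0 // ltW.
pose p t : F := expR (\sum_d th d * u t d) / E th.
have p_gt0 t : 0 < p t by rewrite divr_gt0 ?expR_gt0.
have sum_p : \sum_t p t = 1.
  by rewrite -mulr_suml -/(E th) divff // gt_eqF.
pose mu d : F := \sum_t p t * u t d.
have grad d : `|mu d + dl * th d| <= dl * C.
  (* Near-minimality is tested by moving the coordinate [d] by [c = dl] and [c = - dl]: the slack
     and the second-order terms are all [O(dl ^+ 2)], so dividing by [dl] bounds the gradient. *)
  have step c : `|c| = dl -> - (dl * (dl * C)) <= c * (mu d + dl * th d).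
    move=> c_dl; have cU : `|c| * U <= 2^-1.
      rewrite c_dl; apply: le_trans kU; rewrite ler_wpM2r //.
      exact: le_trans U_ge1.
    have := @ln_sum_expR_perturb F T D u U th d c p u_le cU (E_gt0 th) (fun=> erefl).
    have := min_th (fun d' => th d' + (d' == d)%:R * c).
    rewrite /J -/(E th) -/(E (fun d' => th d' + (d' == d)%:R * c)) -/(mu d).
    have -> : \sum_d0 (th d0 + (d0 == d)%:R * c) ^+ 2 =
              \sum_d0 th d0 ^+ 2 + 2 * c * th d + c ^+ 2.
      rewrite (bigD1 d) //= [in RHS](bigD1 d) //= eqxx mul1r.
      rewrite (eq_bigr (fun i => th i ^+ 2)); last first.
        by move=> i /negPf ->; rewrite mul0r addr0.
      by ring.
    have c2 : c ^+ 2 = dl ^+ 2 by rewrite -c_dl real_normK ?num_real.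
    rewrite c2 => h1 h2.
    have : 0 <= c * mu d + 2 * dl ^+ 2 * U ^+ 2 +
       dl / 2 * (2 * c * th d + dl ^+ 2) + dl ^+ 2 by lra.
    have : dl * dl ^+ 2 <= 1 * dl ^+ 2.
      by rewrite ler_wpM2r ?sqr_ge0 // (le_trans dl_lek).
    have := sqr_ge0 dl; rewrite /C; lra.
  have dl_norm : `|dl| = dl by rewrite gtr0_norm.
  have h1 := step dl dl_norm.
  have h2 := step (- dl) (etrans (normrN dl) dl_norm).
  rewrite mulNr lerNl opprK ler_pM2l // in h2.
  rewrite -mulrN ler_pM2l // in h1.
  by rewrite ler_norml h1 h2.
exists p; split => //.
- by move=> t; exact: ltW.
- move=> d; rewrite -/(mu d); apply: le_trans kX.
  have -> : mu d = (mu d + dl * th d) - dl * th d by ring.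
  apply: le_trans (ler_normB _ _) _; apply: le_trans (lerD (grad d) (lexx _)) _.
  have e1 : dl * C <= k * C by rewrite ler_wpM2r.
  have e2 : `|dl * th d| <= k * M.
    by rewrite normrM gtr0_norm // /dl expr2 -mulrA ler_pM2l.
  have e3 : 0 <= k * (#|D|%:R * M * C).
    exact: mulr_ge0 (ltW k_gt0) (mulr_ge0 (mulr_ge0 (ler0n _ _) M_ge0) C_ge0).
  lra.
(* The entropy of a Gibbs distribution is the Legendre transform of its log-partition function. *)
have ent : \sum_t eta (p t) = ln (E th) - \sum_d th d * mu d.
  transitivity (\sum_t (p t * ln (E th) - p t * \sum_d th d * u t d)).
    apply: eq_bigr => t _; rewrite /eta {2}/p ln_div ?posrE ?expR_gt0 // expRK.
    by ring.
  rewrite sumrB -mulr_suml sum_p mul1r; congr (_ - _).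
  under eq_bigr do rewrite mulr_sumr; rewrite exchange_big /=.
  apply: eq_bigr => d _; rewrite /mu mulr_sumr; apply: eq_bigr => t _.
  by ring.
rewrite ent; apply: (@le_trans _ _ (ln (E th) - e)); first by rewrite lerD2r; exact: le_phi.
rewrite lerD2l lerN2; apply: le_trans kX.
apply: (@le_trans _ _ (\sum_(d : D) k * (M * C))); last first.
  have e3 : 0 <= k * (C + M) by exact: mulr_ge0 (ltW k_gt0) (addr_ge0 C_ge0 M_ge0).
  rewrite sumr_const -mulr_natr; lra.
apply: ler_sum => d _.
have -> : th d * mu d = th d * (mu d + dl * th d) - dl * th d ^+ 2 by ring.
apply: (@le_trans _ _ (th d * (mu d + dl * th d))).
  by rewrite lerBlDr lerDl mulr_ge0 ?sqr_ge0 // ltW.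
apply: le_trans (ler_norm _) _; rewrite normrM.
apply: le_trans (ler_wpM2l (normr_ge0 _) (grad d)) _.
have -> : `|th d| * (dl * C) = k * ((k * `|th d|) * C) by rewrite /dl; ring.
by rewrite ler_pM2l // ler_wpM2r.
Qed.

(** * Rounding to exact types and the entropy lower bound *)

Lemma natr_dist_lt1 (F : realType) (a b : nat) :
  `|a%:R - b%:R : F| < 1 -> a = b.
Proof.
rewrite ltr_norml => /andP[h1 h2].
have : a%:R < b.+1%:R :> F by rewrite -natr1; lra.
have : b%:R < a.+1%:R :> F by rewrite -natr1; lra.
rewrite !ltr_nat !ltnS => le1 le2.
by apply/eqP; rewrite eqn_leq le1 le2.
Qed.

(* Rounding [N p], with [N] given by Dirichlet's theorem, keeps the margins exact
   since they are integers; as Dirichlet's bound on [N] does not depend on [p],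
   the mean of [p] may be taken accurate to less than [1 / N]. *)
Lemma exact_type (F : realType) (T D : finType) (v : T -> D -> nat)
    (a : D -> nat) (t0 : T) (phi e : F) :
    v t0 =1 a ->
    (forall th : D -> F,
       phi <= ln (\sum_t expR (\sum_d th d * ((v t d)%:R - (a d)%:R)))) ->
    0 < e ->
  exists n : T -> nat, exists N : nat,
    [/\ (0 < N)%N, (\sum_t n t = N)%N,
        forall d, (\sum_t n t * v t d = N * a d)%N &
        phi - e <= \sum_t eta ((n t)%:R / N%:R)].
Proof.
move=> v_t0 le_phi e_gt0; pose u t d : F := (v t d)%:R - (a d)%:R.
have [U U_ge1 u_le] := finite_family_bounded u.
pose cT : F := #|T|%:R.
have cT_ge0 : 0 <= cT by rewrite /cT ler0n.
(* Rounding to accuracy [1 / q ^ 2] must move the margins by less than 1/2 ([small1]) and cost at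
   most [e / 2] of entropy ([small2]). *)
pose q := (Num.trunc (2 * cT * U + 4 * cT / e)).+1.
have q_gt0 : 0 < q%:R :> F by rewrite ltr0n.
have q_ge1 : 1 <= q%:R :> F by rewrite ler1n.
have q_big : 2 * cT * U + 4 * cT / e < q%:R by exact: truncnS_gt.
have cTU_ge0 : 0 <= cT * U by rewrite mulr_ge0 //; lra.
have cTe_ge0 : 0 <= cT / e by rewrite divr_ge0 // ltW.
have q2_gt0 : 0 < (q ^ 2)%:R :> F by rewrite ltr0n expn_gt0.
have small1 : cT * U * (q ^ 2)%:R^-1 < 2^-1.
  rewrite ltr_pdivrMr // natrX expr2.
  have : 1 * q%:R <= q%:R * q%:R :> F by rewrite ler_pM2r.
  lra.
have small2 : cT * (2 / q%:R) <= e / 2.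
  rewrite mulrA ler_pdivrMr //.
  have : e * (4 * (cT / e)) <= e * q%:R by rewrite ler_pM2l //; lra.
  have -> : e * (4 * (cT / e)) = 4 * cT by field; rewrite gt_eqF.
  lra.
pose B := ((q ^ 2) ^ #|T|)%N.
have B_gt0 : 0 < B%:R :> F by rewrite ltr0n !expn_gt0.
(* As [N <= B], this makes [N * e' <= 1/3]; with the rounding error below 1/2, the integer margins
   are off by less than 1. *)
pose e' : F := Num.min (e / 2) (3 * B%:R)^-1.
have e'_gt0 : 0 < e' by rewrite lt_min divr_gt0 // invr_gt0 mulr_gt0.
have u_t0 d : u t0 d = 0 by rewrite /u v_t0 subrr.
have [p [p_ge0 sum_p mean_p ent_p]] := gibbs_distribution u_t0 le_phi e'_gt0.
have [N [n [N_gt0 N_le close]]] :=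
  dirichlet_approximation (expn_gt0 q 2 : (0 < q ^ 2)%N) p_ge0.
pose r t : F := (n t)%:R - N%:R * p t.
have r_le t : `|r t| <= (q ^ 2)%:R^-1 by rewrite distrC close.
have N_e' : N%:R * e' <= 3^-1.
  apply: (@le_trans _ _ (B%:R * (3 * B%:R)^-1)).
    by rewrite ler_pM ?ler_nat ?(ltW e'_gt0) // ge_min lexx orbT.
  by rewrite invfM mulrCA divff ?gt_eqF ?mulr1.
have sum_r (w : T -> F) : (forall t, `|w t| <= U) -> `|\sum_t r t * w t| < 2^-1.
  move=> w_le; apply: le_lt_trans small1.
  apply: le_trans (ler_norm_sum _ _ _) _.
  apply: (@le_trans _ _ (\sum_(t : T) (q ^ 2)%:R^-1 * U)).
    by apply: ler_sum => t _; rewrite normrM ler_pM.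
  by rewrite sumr_const -mulr_natr -/cT; lra.
have sum_n : (\sum_t n t = N)%N.
  apply: (@natr_dist_lt1 F).
  have -> : (\sum_t n t)%N%:R - N%:R = \sum_t r t * 1 :> F.
    under [RHS]eq_bigr do rewrite mulr1.
    by rewrite sumrB -mulr_sumr sum_p mulr1 natr_sum.
  apply: lt_trans (sum_r (fun=> 1) _) _; last by lra.
  by move=> _; rewrite normr1.
exists n, N; split => //.
- move=> d; apply: (@natr_dist_lt1 F).
  have -> : (\sum_t n t * v t d)%N%:R - (N * a d)%N%:R =
      \sum_t r t * u t d + N%:R * \sum_t p t * u t d :> F.
    rewrite -{1}sum_n big_distrl /= !natr_sum mulr_sumr -sumrB -big_split /=.
    apply: eq_bigr => t _; rewrite !natrM /r /u; ring.
  apply: le_lt_trans (ler_normD _ _) _.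
  have h1 := sum_r (u^~ d) (u_le^~ d).
  have h2 : `|N%:R * \sum_t p t * u t d| <= 3^-1.
    by apply: le_trans N_e'; rewrite normrM normr_nat ler_wpM2l ?mean_p.
  apply: lt_le_trans (ltr_leD h1 h2) _; lra.
- have : \sum_t (eta (p t) - 2 / q%:R) <= \sum_t eta ((n t)%:R / N%:R).
    apply: ler_sum => t _; apply: eta_rational_approx; rewrite ?p_ge0 ?close //.
    by rewrite -sum_n (bigD1 t) //= leq_addr.
  rewrite sumrB sumr_const -[X in _ - X]mulr_natl -/cT.
  have : e' <= e / 2 by rewrite ge_min lexx.
  lra.
Qed.

(** A word of exact type, arranged over an [s] by [s] table in all possible ways, gives
    exponentially many total clones; the pigeonhole bound turns them into clones of order [s ^ 2],
    and the losses, of order [s * ln s], are absorbed by [s ^ 2 * e]. *)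
Lemma clones_entropy_bound (F : realType) (T D1 D2 : finType)
    (row : T -> D1 -> nat) (col : T -> D2 -> nat)
    (R : D1 -> nat) (C : D2 -> nat) (t0 : T) (phi e : F) :
    row t0 =1 R -> col t0 =1 C ->
    (forall (th1 : D1 -> F) (th2 : D2 -> F),
       phi <= ln (\sum_t expR (\sum_i th1 i * ((row t i)%:R - (R i)%:R) +
                               \sum_j th2 j * ((col t j)%:R - (C j)%:R)))) ->
    0 < e ->
  exists2 s : nat, (0 < s)%N &
    (s ^ 2)%:R * (phi - e) <= ln #|clones 'I_s row col R C|%:R.
Proof.
move=> row_t0 col_t0 le_phi e_gt0.
pose v t (d : D1 + D2) := match d with inl i => row t i | inr j => col t j end.
pose a (d : D1 + D2) := match d with inl i => R i | inr j => C j end.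
have v_t0 : v t0 =1 a by case.
have le_phi' (th : D1 + D2 -> F) :
    phi <= ln (\sum_t expR (\sum_d th d * ((v t d)%:R - (a d)%:R))).
  apply: le_trans (le_phi (th \o inl) (th \o inr)) _.
  by under [in leRHS]eq_bigr do rewrite big_sumType.
have e2_gt0 : 0 < e / 2 by rewrite divr_gt0.
have [n [N [N_gt0 sum_n mean_n ent_n]]] := exact_type v_t0 le_phi' e2_gt0.
pose B := (\sum_t (\sum_i row t i + \sum_j col t j))%N.
have row_le t i : (row t i <= B)%N.
  by rewrite /B (bigD1 t) //= (bigD1 i) //= -!addnA leq_addr.
have col_le t j : (col t j <= B)%N.
  rewrite /B (bigD1 t) //= [X in (_ + X + _)%N](bigD1 j) //=.
  by rewrite addnAC addnC -!addnA leq_addr.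
pose dD := (#|D1| + #|D2|)%N.
pose X : F := 3 * #|T|%:R + 2 * dD%:R * B%:R.
have X_ge0 : 0 <= X by rewrite addr_ge0 ?mulr_ge0.
(* Taking [s = r ^ 2] makes the total loss at most [s * r * X], the logarithms being bounded by
   linear terms; [k] is chosen so that this is at most [s ^ 2 * e / 2]. *)
pose k := (Num.trunc (2 * X / e)).+1.
pose r := (N * k)%N; pose s := (r ^ 2)%N.
have r_gt0 : (0 < r)%N by rewrite muln_gt0 N_gt0.
have s_gt0 : (0 < s)%N by rewrite expn_gt0 r_gt0.
have r_ge1 : 1 <= r%:R :> F by rewrite ler1n.
have X_le : X <= r%:R * (e / 2).
  have : 2 * X / e < k%:R by exact: truncnS_gt.
  have : k%:R <= r%:R :> F by rewrite ler_nat leq_pmull.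
  rewrite ltr_pdivrMr // => h1 h2.
  have : k%:R * e <= r%:R * e by rewrite ler_pM2r.
  lra.
(* The multiplicity for which [K] copies of the type fill exactly the [s ^ 2] cells. *)
pose K := (N ^ 3 * k ^ 4)%N.
have K_gt0 : (0 < K)%N by rewrite muln_gt0 !expn_gt0 N_gt0.
have KN : (K * N = s * s)%N by rewrite /K /s /r; ring.
pose w := flatten [seq nseq (K * n t) t | t <- enum T].
have sum_w (G : T -> nat) : (\sum_(x <- w) G x = \sum_t K * n t * G t)%N.
  rewrite big_flatten big_map big_enum /=; apply: eq_bigr => t _.
  by rewrite big_nseq iter_addn_0 mulnC.
have count_w t : (count_mem t w = K * n t)%N.
  rewrite -sum1_count big_mkcond sum_w (bigD1 t) //= eqxx muln1 big1 ?addn0 //.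
  by move=> i /negPf ->; rewrite muln0.
have size_w : size w = (s * s)%N.
  rewrite -sum1_size sum_w -KN -sum_n big_distrr /=.
  by apply: eq_bigr => t _; rewrite muln1.
have total_ge : (size (permutations w) <= #|total_clones 'I_s row col R C|)%N.
  apply: leq_size_permutations; rewrite !card_ord // => d; rewrite sum_w -KN.
  - under eq_bigr do rewrite -mulnA.
    by rewrite -big_distrr (mean_n (inl d)) /= mulnA.
  - under eq_bigr do rewrite -mulnA.
    by rewrite -big_distrr (mean_n (inr d)) /= mulnA.
have [x total_le clones_ge] :=
  leq_card_total_clones R C s_gt0 row_le col_le.
exists (s ^ 2)%N; first by rewrite expn_gt0 s_gt0.
have perm_gt0 : (0 < size (permutations w))%N.
  move: (fact_gt0 (size w)).
  by rewrite -size_permutations_fact muln_gt0 => /andP[].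
have x_gt0 : (0 < x)%N.
  by move: (leq_trans (leq_trans perm_gt0 total_ge) total_le); case: (x).
have pow_gt0 : (0 < (s * B).+1 ^ (s * dD))%N by rewrite expn_gt0.
have ln_x : ln (size (permutations w))%:R <=
    ln x%:R + (s * dD)%:R * ln (s * B).+1%:R :> F.
  apply: (@le_trans _ _ (ln (x * (s * B).+1 ^ (s * dD))%:R)).
    rewrite ler_ln ?posrE ?ltr0n ?muln_gt0 ?x_gt0 ?pow_gt0 //.
    by rewrite ler_nat (leq_trans total_ge).
  rewrite natrM lnM ?posrE ?ltr0n // natrX lnXn ?ltr0n //.
  by rewrite lerD2l mulr_natl.
have ln_c : (s ^ 2)%:R * ln x%:R <= ln #|clones 'I_(s ^ 2) row col R C|%:R :> F.
  rewrite mulr_natl -lnXn ?ltr0n // -natrX ler_ln ?posrE ?ltr0n ?expn_gt0 ?x_gt0 //.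
    by rewrite ler_nat.
  by apply: leq_trans clones_ge; rewrite expn_gt0 x_gt0.
have ent := ln_size_permutations F N_gt0 K_gt0 sum_n count_w.
rewrite KN in ent.
have s_ge1 : 1 <= s%:R :> F by rewrite ler1n.
have sE : s%:R = r%:R * r%:R :> F by rewrite -natrM mulnn.
have ln1 : ln (s * s).+1%:R <= 2 * s%:R :> F.
  apply: (@le_trans _ _ (ln (s.+1%:R ^+ 2))).
    rewrite ler_ln ?posrE ?exprn_gt0 ?ltr0n // -natrX ler_nat.
    by rewrite -addn1 -(addn1 s) sqrnD exp1n mulnn leq_addr.
  rewrite lnXn ?ltr0n // -[leLHS]mulr_natl ler_pM2l //.
  by apply: le_trans (ln_le_subr1 _) _; rewrite ?ltr0n // -natr1 addrK.
have ln2 : ln (s * B).+1%:R <= 2 * (r%:R * B%:R) :> F.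
  apply: (@le_trans _ _ (ln ((r * B).+1%:R ^+ 2))).
    rewrite ler_ln ?posrE ?exprn_gt0 ?ltr0n // -natrX ler_nat /s.
    rewrite -addn1 -(addn1 (r * B)) sqrnD exp1n expnMn.
    rewrite (leq_trans _ (leq_addr _ _)) // leq_add2r leq_mul2l -[(B ^ 2)%N]mulnn.
    by apply/orP; right; case: (B) => // b; exact: leq_pmull.
  rewrite lnXn ?ltr0n // -[leLHS]mulr_natl ler_pM2l //.
  by apply: le_trans (ln_le_subr1 _) _; rewrite ?ltr0n // -natr1 addrK natrM.
have loss1 : #|T|%:R * (ln (s * s).+1%:R + 1) <= s%:R * (r%:R * (3 * #|T|%:R)) :> F.
  apply: (@le_trans _ _ (#|T|%:R * (3 * s%:R))).
    by rewrite ler_wpM2l //; lra.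
  have : (s%:R * #|T|%:R * 3) * 1 <= (s%:R * #|T|%:R * 3) * r%:R :> F.
    by rewrite ler_wpM2l // !mulr_ge0.
  lra.
have loss2 : (s * dD)%:R * ln (s * B).+1%:R <=
    s%:R * (r%:R * (2 * dD%:R * B%:R)) :> F.
  apply: (@le_trans _ _ ((s * dD)%:R * (2 * (r%:R * B%:R)))).
    by rewrite ler_wpM2l.
  by rewrite natrM; lra.
have loss : s%:R * (r%:R * X) <= (s * s)%:R * (e / 2).
  have -> : (s * s)%:R * (e / 2) = s%:R * (r%:R * (r%:R * (e / 2))).
    by rewrite natrM {2}sE; ring.
  by rewrite !ler_wpM2l.
have main : (s * s)%:R * (phi - e) <= ln x%:R.
  have : (s * s)%:R * (phi - e / 2) <=
         (s * s)%:R * \sum_t eta ((n t)%:R / N%:R) by rewrite ler_wpM2l.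
  move: loss; rewrite /X; lra.
apply: le_trans ln_c.
by rewrite -[((s ^ 2) ^ 2)%N]mulnn natrM -mulrA ler_wpM2l // -[(s ^ 2)%N]mulnn.
Qed.

(** * Tables as functions to blocks *)

Lemma card_fset_set_imset (T : finType) (U : choiceType) (f : T -> U)
    (X : {set T}) (A : set U) :
    {in X &, injective f} -> (forall y, A y <-> exists2 x, x \in X & y = f x) ->
  #|` fset_set A|%fset = #|X|.
Proof.
move=> f_inj AP.
have A_fin : finite_set A.
  apply: (@sub_finite_set _ _ (range f)); last exact/finite_image/finite_finset.
  by move=> y /AP[x _ ->]; exists x.
have -> : fset_set A = [fset f x | x in X]%fset.
  apply/fsetP => y; rewrite in_fset_set //.
  apply/idP/imfsetP => [/set_mem/AP[x xX ->]|[x xX ->]]; first by exists x.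
  by apply/mem_set/AP; exists x.
rewrite card_in_imfset // cardE; apply: perm_size.
apply: uniq_perm => [||x]; rewrite ?enum_finmem_uniq ?enum_uniq //.
Qed.

Definition max_entry (m n : nat) (K : 'M[nat]_(m, n)) : nat :=
  (\sum_(z : 'I_m * 'I_n) K z.1 z.2)%N.

Definition bounded_entries (m n : nat) (K : 'M[nat]_(m, n)) :
    pred {ffun 'I_m * 'I_n -> 'I_(max_entry K).+1} :=
  family (fun z => [pred t : 'I_(max_entry K).+1 | (t < (K z.1 z.2).+1)%N]).

Arguments bounded_entries {m n} K _.

(** A subtype of finite functions is a [finType], as [clones] requires, and its [family] predicate
    is the one produced by distributing a product over sums. *)
Definition block (m n : nat) (K : 'M[nat]_(m, n)) : finType :=
  {f : {ffun 'I_m * 'I_n -> 'I_(max_entry K).+1} | f \in bounded_entries K}.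

Definition entry (m n : nat) (K : 'M[nat]_(m, n)) (t : block K) (i : 'I_m)
    (j : 'I_n) : nat := val t (i, j).

Definition block_row (m n : nat) (K : 'M[nat]_(m, n)) (t : block K)
    (i : 'I_m) : nat := (\sum_j entry t i j)%N.

Definition block_col (m n : nat) (K : 'M[nat]_(m, n)) (t : block K)
    (j : 'I_n) : nat := (\sum_i entry t i j)%N.

Lemma entry_le (m n : nat) (K : 'M[nat]_(m, n)) (t : block K) i j :
  (entry t i j <= K i j)%N.
Proof. by have /familyP/(_ (i, j)) := valP t; rewrite inE. Qed.

(** A sigma-type rather than an existential, so that blocks can be extracted inside the definition
    of a function. *)
Lemma block_of_matrix (m n : nat) (K A : 'M[nat]_(m, n)) :
    (forall i j, (A i j <= K i j)%N) ->
  {t : block K | forall i j, entry t i j = A i j}.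
Proof.
move=> le_AK.
have le_max i j : (K i j <= max_entry K)%N.
  by rewrite /max_entry (bigD1 (i, j)) //= leq_addr.
pose f : {ffun 'I_m * 'I_n -> 'I_(max_entry K).+1} := [ffun z => inord (A z.1 z.2)].
have fE i j : f (i, j) = A i j :> nat.
  by rewrite ffunE inordK // ltnS (leq_trans (le_AK i j)).
have f_bnd : f \in bounded_entries K.
  by apply/familyP => -[i j]; rewrite inE fE /= ltnS.
by exists (Sub f f_bnd) => i j; rewrite /entry SubK fE.
Qed.

(** Expanding the product picks one exponent per cell, that is a block, whose monomial is determined
    by its margins. *)
Lemma genfun_sum_block (F : realType) (m n : nat) (K : 'M[nat]_(m, n))
    (x : 'rV[F]_m) (y : 'rV[F]_n) :
  genfun K x y = \sum_(t : block K)
    (\prod_i x 0 i ^+ block_row t i) * (\prod_j y 0 j ^+ block_col t j).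
Proof.
rewrite /genfun pair_bigA /=.
transitivity (\prod_(z : 'I_m * 'I_n)
  \sum_(t < (max_entry K).+1 | (t < (K z.1 z.2).+1)%N) (x 0 z.1 * y 0 z.2) ^+ t).
  apply: eq_bigr => z _; rewrite (big_ord_widen (max_entry K).+1 (GRing.exp _)) //.
  by rewrite ltnS /max_entry (bigD1 z) //= leq_addr.
rewrite bigA_distr_big_dep (big_sub (bounded_entries K)).
apply: eq_bigr => t _.
under eq_bigr do rewrite exprMn.
rewrite big_split /=; congr (_ * _).
- transitivity (\prod_i \prod_j x 0 i ^+ entry t i j).
    by rewrite pair_bigA; apply: eq_bigr => -[].
  by apply: eq_bigr => i _; rewrite prodrXr.
- transitivity (\prod_j \prod_i y 0 j ^+ entry t i j).
    by rewrite exchange_big pair_bigA; apply: eq_bigr => -[].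
  by apply: eq_bigr => j _; rewrite prodrXr.
Qed.

Lemma sum_tagnat (s m : nat) (G : 'I_s -> 'I_m -> nat) :
  (\sum_(J < \sum_(a < s) m) G (tagnat.sig1 J) (tagnat.sig2 J) =
   \sum_a \sum_i G a i)%N.
Proof. by rewrite [RHS]sig_big_dep (reindex _ tagnat.sig_bij_on). Qed.

(** [h] glues a table of blocks into one large matrix; the [tagnat] bijection between a large index
    and a pair (block, position) makes it a bijection onto the tables. *)
Lemma num_tables_clones (s m n : nat) (K : 'M[nat]_(m, n)) (R : 'rV[nat]_m)
    (C : 'rV[nat]_n) :
  num_tables (clone_bound s K) (clone_margin s R) (clone_margin s C) =
  #|clones 'I_s (@block_row m n K) (@block_col m n K) (R 0) (C 0)|.
Proof.
pose h (f : {ffun 'I_s * 'I_s -> block K}) :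
    'M[nat]_(\sum_(a < s) m, \sum_(b < s) n) :=
  \matrix_(I, J) entry (f (tagnat.sig1 I, tagnat.sig1 J))
                       (tagnat.sig2 I) (tagnat.sig2 J).
have mulE (k p : nat) : k *+ p = (p * k)%N.
  by elim: p => [|p IHp]; rewrite ?mulr0n // mulrS IHp mulSn.
have marginE p (V : 'rV[nat]_p) I :
    clone_margin s V 0 I = (s * V ord0 (tagnat.sig2 I))%N.
  by rewrite mxE mulmxnE mulE.
have h_row f I : (\sum_J h f I J =
    \sum_b block_row (f (tagnat.sig1 I, b)) (tagnat.sig2 I))%N.
  under eq_bigr do rewrite mxE.
  exact: (sum_tagnat (fun b j => entry (f (tagnat.sig1 I, b)) (tagnat.sig2 I) j)).
have h_col f J : (\sum_I h f I J =
    \sum_a block_col (f (a, tagnat.sig1 J)) (tagnat.sig2 J))%N.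
  under eq_bigr do rewrite mxE.
  exact: (sum_tagnat (fun a i => entry (f (a, tagnat.sig1 J)) i (tagnat.sig2 J))).
pose rk p (a : 'I_s) (i : 'I_p) := @tagnat.Rank s (fun=> p) a i.
have rk1 p a i : tagnat.sig1 (@rk p a i) = a by exact: tagnat.Rank1K.
have rk2 p a i : tagnat.sig2 (@rk p a i) = i :> 'I_p.
  by apply: val_inj; rewrite /= tagnat.Rank2K.
have rkK p I : @rk p (tagnat.sig1 I) (tagnat.sig2 I) = I by exact: tagnat.sig2K.
have h_inj : injective h.
  move=> f1 f2 /matrixP eqh; apply/ffunP => -[a b]; apply/val_inj/ffunP => -[i j].
  have := eqh (rk m a i) (rk n b j); rewrite !mxE !rk1 !rk2.
  exact: val_inj.
apply: (card_fset_set_imset (f := h)); first exact: in2W.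
move=> A; split=> [[Ar Ac le_A] | [f /clonesP[fr fc] ->]].
- have le_blk z i j : ((\matrix_(i, j) A (rk m z.1 i) (rk n z.2 j)) i j <= K i j)%N.
    by rewrite mxE; apply: leq_trans (le_A _ _) _; rewrite mxE !rk2.
  pose f : {ffun 'I_s * 'I_s -> block K} :=
    [ffun z => sval (block_of_matrix (le_blk z))].
  have hf : A = h f.
    apply/matrixP => I J; rewrite mxE ffunE.
    by case: block_of_matrix => t /= ->; rewrite mxE !rkK.
  exists f => //; apply/clonesP; split=> [a i | b j].
  + by rewrite card_ord; have := Ar (rk m a i); rewrite hf h_row marginE rk1 rk2.
  + by rewrite card_ord; have := Ac (rk n b j); rewrite hf h_col marginE rk1 rk2.
- split=> [I | J | I J].
  + by rewrite h_row marginE fr card_ord.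
  + by rewrite h_col marginE fc card_ord.
  + by rewrite !mxE entry_le.
Qed.

(** Expanding the power gives a sum over all tables of blocks: each clone contributes exactly 1, as
    its margins sum up to [s ^ 2] times [(R, C)], and the other terms are nonnegative. *)
Lemma card_clones_le (F : realType) (s : nat) (T D1 D2 : finType)
    (row : T -> D1 -> nat) (col : T -> D2 -> nat)
    (R : D1 -> nat) (C : D2 -> nat) (x : D1 -> F) (y : D2 -> F) :
    (forall i, 0 < x i) -> (forall j, 0 < y j) ->
  #|clones 'I_s row col R C|%:R <=
  ((\sum_t (\prod_i x i ^+ row t i) * (\prod_j y j ^+ col t j)) /
   ((\prod_i x i ^+ R i) * (\prod_j y j ^+ C j))) ^+ (s ^ 2).
Proof.
move=> x_gt0 y_gt0.
set M : F := (\prod_i x i ^+ R i) * _.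
pose wt t := (\prod_i x i ^+ row t i) * (\prod_j y j ^+ col t j) / M.
have M_gt0 : 0 < M by rewrite mulr_gt0 ?prodr_gt0 // => k _; rewrite exprn_gt0.
have wt_ge0 t : 0 <= wt t.
  by rewrite divr_ge0 ?(ltW M_gt0) // mulr_ge0 // prodr_ge0 // => k _;
    rewrite exprn_ge0 // ltW.
rewrite mulr_suml -/(wt _).
have -> : (\sum_t wt t) ^+ (s ^ 2) =
    \sum_(f : {ffun 'I_s * 'I_s -> T}) \prod_q wt (f q).
  rewrite -(bigA_distr_bigA (fun _ t => wt t)) prodr_const /=.
  by rewrite card_prod card_ord mulnn.
rewrite -sum1_card natr_sum big_mkcond /=; apply: ler_sum => f _.
case: ifPn => [/clonesP[fr fc]|_]; last by apply: prodr_ge0 => q _.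
suff -> : \prod_q wt (f q) = 1 by [].
have sum_r i : (\sum_q row (f q) i = R i * (s * s))%N.
  transitivity (\sum_a \sum_b row (f (a, b)) i)%N.
    by rewrite pair_bigA; apply: eq_bigr => -[].
  under eq_bigr do rewrite fr; rewrite sum_nat_const !card_ord.
  by rewrite mulnA mulnC.
have sum_c j : (\sum_q col (f q) j = C j * (s * s))%N.
  transitivity (\sum_b \sum_a col (f (a, b)) j)%N.
    by rewrite exchange_big pair_bigA; apply: eq_bigr => -[].
  under eq_bigr do rewrite fc; rewrite sum_nat_const !card_ord.
  by rewrite mulnA mulnC.
rewrite /wt prodf_div big_split /= exchange_big.
rewrite [X in _ * X / _]exchange_big /=.
under eq_bigr do rewrite prodrXr sum_r exprM.
under [X in _ * X / _]eq_bigr do rewrite prodrXr sum_c exprM.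
rewrite !prodrXl -exprMn -/M prodr_const card_prod card_ord divff //.
by rewrite expf_neq0 ?gt_eqF.
Qed.

(** * The limit *)

Theorem theorem2 (F : realType) (m n : nat)
    (R : 'rV[nat]_m) (C : 'rV[nat]_n) (K : 'M[nat]_(m, n))
    (R_gt0 : forall i, (0 < R 0%R i)%N)
    (C_gt0 : forall j, (0 < C 0%R j)%N)
    (K_gt0 : forall i j, (0 < K i j)%N)
    (T_gt0 : (0 < num_tables K R C)%N) :
  (fun s : nat =>
     (s%:R ^+ 2)^-1 *
     ln ((num_tables (clone_bound s K) (clone_margin s R)
                     (clone_margin s C))%:R : F)) @ \oo -->
  ln (inf [set z : F | exists (x : 'rV[F]_m) (y : 'rV[F]_n),
             [/\ (forall i, 0 < x 0 i), (forall j, 0 < y 0 j) &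
                 z = genfun K x y / (monomial R x * monomial C y)]]).
Proof.
set S := [set z : F | _].
have [t0 [t0_row t0_col]] : exists t0 : block K,
    block_row t0 =1 R 0 /\ block_col t0 =1 C 0.
  move: T_gt0; rewrite /num_tables cardfs_gt0 => /fset0Pn[A0].
  rewrite in_fset_set; last exact: finite_tables.
  move=> /set_mem[Ar Ac le_A].
  have [t tE] := block_of_matrix le_A; exists t; split=> [i | j].
    by rewrite -Ar; apply: eq_bigr => j _; rewrite tE.
  by rewrite -Ac; apply: eq_bigr => i _; rewrite tE.
pose T s := #|clones 'I_s (@block_row m n K) (@block_col m n K) (R 0) (C 0)|.
have mono_gt0 (x : 'rV[F]_m) (y : 'rV[F]_n) :
    (forall i, 0 < x 0 i) -> (forall j, 0 < y 0 j) ->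
    0 < monomial R x * monomial C y.
  by move=> x_gt0 y_gt0; rewrite mulr_gt0 ?prodr_gt0 // => k _; rewrite exprn_gt0.
(* The term of [t0] in the expansion of [genfun] is the denominator itself; so the infimum is at
   least 1 and its logarithm is a genuine one. *)
have S_ge1 z : S z -> 1 <= z.
  move=> [x [y [x_gt0 y_gt0 ->]]].
  rewrite ler_pdivlMr ?mono_gt0 // mul1r genfun_sum_block (bigD1 t0) //=.
  have -> : monomial R x = \prod_i x 0 i ^+ block_row t0 i.
    by apply: eq_bigr => i _; rewrite t0_row.
  have -> : monomial C y = \prod_j y 0 j ^+ block_col t0 j.
    by apply: eq_bigr => j _; rewrite t0_col.
  rewrite lerDl sumr_ge0 // => t _.
  by rewrite mulr_ge0 // prodr_ge0 // => k _; rewrite exprn_ge0 // ltW.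
have S_neq0 : S !=set0.
  pose x := const_mx 1 : 'rV[F]_m; pose y := const_mx 1 : 'rV[F]_n.
  exists (genfun K x y / (monomial R x * monomial C y)); exists x, y.
  by split=> // i; rewrite mxE.
have inf_ge1 : 1 <= inf S by apply: lb_le_inf => // z; exact: S_ge1.
have inf_le z : S z -> inf S <= z by apply: ge_inf; exists 1 => ?; exact: S_ge1.
have phi_ge0 : 0 <= ln (inf S) by exact: ln_ge0.
set phi := ln (inf S) in phi_ge0 *.
(* The substitution [x = expR th1], [y = expR th2] turns the partition function into an element of
   [S]. *)
have le_phi (th1 : 'I_m -> F) (th2 : 'I_n -> F) :
    phi <= ln (\sum_t expR
      (\sum_i th1 i * ((block_row t i)%:R - (R 0 i)%:R) +
       \sum_j th2 j * ((block_col (K := K) t j)%:R - (C 0 j)%:R))).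
  pose x := \row_i expR (th1 i); pose y := \row_j expR (th2 j).
  have x_gt0 i : 0 < x 0 i by rewrite mxE expR_gt0.
  have y_gt0 i : 0 < y 0 i by rewrite mxE expR_gt0.
  set z := \sum_t _.
  suff Sz : S z.
    by rewrite ler_ln ?posrE ?inf_le // (lt_le_trans ltr01) // S_ge1.
  exists x, y; split => //.
  rewrite genfun_sum_block mulr_suml; apply: eq_bigr => t _.
  have expE (p : nat) (th : 'I_p -> F) (k l : 'I_p -> nat) :
      expR (\sum_i th i * ((k i)%:R - (l i)%:R)) =
      (\prod_i expR (th i) ^+ k i) / (\prod_i expR (th i) ^+ l i).
    rewrite expR_sum -prodf_div; apply: eq_bigr => i _.
    by rewrite mulrBr expRD expRN -!expRM_natr.
  rewrite expRD !expE /monomial; under [X in _ = X * _ / _]eq_bigr do rewrite mxE.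
  under [X in _ = _ * X / _]eq_bigr do rewrite mxE.
  under [X in _ = _ / (X * _)]eq_bigr do rewrite mxE.
  under [X in _ = _ / (_ * X)]eq_bigr do rewrite mxE.
  by rewrite invfM mulrACA.
have T_ge1 s : (0 < T s)%N.
  rewrite card_gt0; apply/set0Pn; exists [ffun=> t0]; apply/clonesP; split.
  - move=> a i; under eq_bigr do rewrite ffunE t0_row.
    by rewrite sum_nat_const.
  - move=> a i; under eq_bigr do rewrite ffunE t0_col.
    by rewrite sum_nat_const.
have upper s : ln (T s)%:R <= s%:R ^+ 2 * phi.
  have [->|s_gt0] := posnP s.
    have := @card_clones_le F 0 _ _ _ (@block_row m n K) (@block_col m n K)
      (R 0) (C 0) (fun=> 1) (fun=> 1) (fun=> ltr01) (fun=> ltr01).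
    by rewrite expr0n mul0r /= expr0 => /ln_le0.
  have s2_gt0 : 0 < s%:R ^+ 2 :> F by rewrite exprn_gt0 // ltr0n.
  rewrite mulrC -ler_pdivrMr // -ler_expR lnK ?posrE ?(lt_le_trans ltr01) //.
  apply: lb_le_inf => // z Sz; have z_ge1 := S_ge1 z Sz.
  have z_gt0 : 0 < z by rewrite (lt_le_trans ltr01).
  rewrite -[leRHS]lnK ?posrE // ler_expR ler_pdivrMr // mulrC -natrX.
  rewrite mulr_natl -lnXn // ler_ln ?posrE ?exprn_gt0 ?ltr0n //.
  have [x [y [x_gt0 y_gt0 ->]]] := Sz.
  by rewrite genfun_sum_block; exact: card_clones_le.
under eq_fun do rewrite num_tables_clones -/(T _).
apply/cvgrPdist_le => e e_gt0.
have e2_gt0 : 0 < e / 2 by rewrite divr_gt0.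
have [r r_gt0 T_r] := clones_entropy_bound t0_row t0_col le_phi e2_gt0.
near=> s.
have s_gt0 : (0 < s)%N by near: s; exact: nbhs_infty_ge.
have s_gt0' : 0 < s%:R :> F by rewrite ltr0n.
have s2_gt0 : 0 < s%:R ^+ 2 :> F by rewrite exprn_gt0.
(* From this threshold on, the loss [2 * r * s * phi] due to replacing [s] by a multiple of [r] is
   at most [s ^ 2 * e / 2]. *)
have s_big : 4 * r%:R * phi / e <= s%:R by near: s; exact: nbhs_infty_ger.
have upper_s : (s%:R ^+ 2)^-1 * ln (T s)%:R <= phi.
  by rewrite mulrC ler_pdivrMr // mulrC upper.
suff lower_s : phi - e <= (s%:R ^+ 2)^-1 * ln (T s)%:R.
  by rewrite ger0_norm; lra.
rewrite [leRHS]mulrC ler_pdivlMr //.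
pose g := (s %/ r * r)%N.
have g_le : g%:R <= s%:R :> F by rewrite ler_nat leq_trunc_div.
have g_ge : s%:R - r%:R <= g%:R :> F.
  by rewrite lerBlDr -natrD ler_nat {1}(divn_eq s r) leq_add2l ltnW ?ltn_pmod.
have T_s : g%:R ^+ 2 * (phi - e / 2) <= ln (T s)%:R.
  apply: (@le_trans _ _ (((s %/ r) ^ 2)%:R * ln (T r)%:R)).
    apply: le_trans (ler_wpM2l (ler0n _ _) T_r).
    by rewrite mulrA -natrM -expnMn natrX.
  rewrite mulr_natl -lnXn ?ltr0n // -natrX ler_ln ?posrE ?ltr0n ?expn_gt0 ?T_ge1 //.
  by rewrite ler_nat (leq_card_clones_divn _ _ t0_row t0_col).
apply: le_trans T_s.
(* If [phi - e / 2 <= 0], the bound [g <= s] is the useful one; otherwise [g] must be bounded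
   below. *)
have [phi_le | phi_gt] := leP phi (e / 2).
  apply: (@le_trans _ _ (s%:R ^+ 2 * (phi - e / 2))).
    by rewrite mulrC ler_pM2l //; lra.
  rewrite ler_wnM2r ?subr_le0 //.
  by rewrite ler_sqr ?nnegrE.
have [s_lt | s_ge] := ltP (s%:R : F) r%:R; last first.
  have g2 : s%:R ^+ 2 - 2 * r%:R * s%:R <= g%:R ^+ 2 :> F.
    apply: (@le_trans _ _ ((s%:R - r%:R) ^+ 2)).
      by rewrite sqrrB; have := sqr_ge0 (r%:R : F); rewrite -mulr_natl; lra.
    by rewrite ler_sqr ?nnegrE // subr_ge0.
  have phi_e2 : 0 <= phi - e / 2 by rewrite subr_ge0 ltW.
  apply: le_trans (ler_wpM2r phi_e2 g2).
  rewrite ler_pdivrMr // in s_big.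
  have b1 : s%:R * (4 * r%:R * phi) <= s%:R * (s%:R * e) by rewrite ler_pM2l.
  have b2 : 0 <= r%:R * s%:R * e by rewrite !mulr_ge0 // ltW.
  have -> : (phi - e) * s%:R ^+ 2 = s%:R ^+ 2 * (phi - e / 2) - s%:R * (s%:R * e) / 2.
    by field.
  have -> : (s%:R ^+ 2 - 2 * r%:R * s%:R) * (phi - e / 2) =
    s%:R ^+ 2 * (phi - e / 2) - s%:R * (4 * r%:R * phi) / 2 + r%:R * s%:R * e.
    by field.
  lra.
exfalso; move: s_lt; apply/negP; rewrite -leNgt ler_nat.
by near: s; exact: nbhs_infty_ge.
Unshelve. all: by end_near.
Qed.
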